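(* With $U_T$ and $U$ as in the context, consider the conditions: [A3] $\displaystyle U\supset\bigcap_{N=1}^\infty\overline{\bigcup_{T\ge N}U_T}$. [An] For some positive constants $\{b_T\}_{T\in\mathbb T}$ with $b_T\to\infty$, $\{U_T/b_T;\ T\in\mathbb T\}$ is locally approximated by some cone $\Lambda$. [Ch1] $\mathbb T=\mathbb Z_{\ge1}$ (the positive integers), and $a_T=T^{-1/2}I_{\mathsf p}$ for all $T$. [Ch2] $\{\Theta-\theta^*;\ T\in\mathbb T\}$ (the constant family) is locally approximated by some cone $\Lambda$. Then: (i) If [An] holds, then [A3] holds, and $U=\overline\Lambda$. (ii) Assume [Ch1]. Then [A3] holds if and only if [Ch2] holds. Furthermore, in this case, $U=\overline\Lambda$.
   Context: $\Theta\subset\mathbb R^{\mathsf p}$ is measurable, $\theta^*\in\Theta$, $\mathbb T\subset\mathbb R$ with $\sup\mathbb T=\infty$ (all indices $T$ range over $\mathbb T$), and $a_T\in GL(\mathsf p)$ are deterministic matrices with $\|a_T\|\to0$ as $T\to\infty$. Define $$U_T=\{u\in\mathbb R^{\mathsf p};\ \theta^*+a_Tu\in\Theta\},\qquad U=\bigcap_{\delta>0}\bigcup_{N=1}^\infty\bigcap_{T\ge N}U_T^{\,\delta},$$ where $A^\delta=\{x\in\mathbb R^{\mathsf p};\inf_{a\in A}|x-a|<\delta\}$. A cone (with vertex at the origin) is a non-empty set $\Lambda\subset\mathbb R^{\mathsf p}$ such that $t\lambda\in\Lambda$ for all $\lambda\in\Lambda$ and $t\ge0$. A family $\{\Phi_T\subset\mathbb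 R^{\mathsf p};T\in\mathbb T\}$ is locally approximated (at the origin) by a cone $\Lambda\subset\mathbb R^{\mathsf p}$ if, as $T\to\infty$, $$d(\phi_T,\Lambda)=o(|\phi_T|)\quad\text{for all }\{\phi_T\in\Phi_T;T\in\mathbb T\}\text{ with }|\phi_T|\to0,$$ $$d(\lambda_T,\Phi_T)=o(|\lambda_T|)\quad\text{for all }\{\lambda_T\in\Lambda;T\in\mathbb T\}\text{ with }|\lambda_T|\to0,$$ where $d(x,A)=\inf_{a\in A}|x-a|$. In (i), $\Lambda$ is the cone from [An]; in (ii), $\Lambda$ is the cone from [Ch2]. *)

(* Defs.v *)
From HB Require Import structures.
From mathcomp Require Import all_boot all_order all_algebra.
From mathcomp Require Import all_classical all_reals all_analysis.

Set Implicit Arguments.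
Unset Strict Implicit.
Unset Printing Implicit Defensive.

Import Order.TTheory GRing.Theory Num.Theory.
Import numFieldNormedType.Exports.

Local Open Scope classical_set_scope.
Local Open Scope ring_scope.

Section Geometry.
Context {R : realType} {p : nat}.
Implicit Types (x u : 'cV[R]_p) (A L : set 'cV[R]_p).

(* The library norm on matrices is the entrywise maximum, so the Euclidean
   norm has to be introduced; both induce the same (library) topology. *)
Definition enorm x : R := Num.sqrt (\sum_i x i 0 ^+ 2).

(* The set is nonempty and bounded above, so [sup] is a genuine supremum. *)
Definition opnorm (M : 'M[R]_p) : R :=
  sup [set enorm (M *m u) | u in [set u | enorm u <= 1]].

(* Extended-real valued, so that the distance to the empty set is +oo. *)
Definition dist_set x A : \bar R :=
  ereal_inf [set (enorm (x - a))%:E | a in A].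

Definition thickening (delta : R) A : set 'cV[R]_p :=
  [set x | (dist_set x A < delta%:E)%E].

Definition borel_set A : Prop :=
  <<s [set B : set 'cV[R]_p | open B] >> A.

Definition is_cone L : Prop :=
  L !=set0 /\ forall l t, L l -> 0 <= t -> L (t *: l).

End Geometry.

(* Families indexed by TT are functions on all of R, of which only the values
   on TT matter; [at_infty TT] is the filter "T tends to infinity inside TT". *)
Definition at_infty {R : realType} (TT : set R) : set_system R :=
  within TT (pinfty_nbhs R).

Section LocalApproximation.
Context {R : realType} {p : nat}.

(* d(phi_T, A_T) = o(|phi_T|); dist_set being extended-real valued, the
   definition of little-o is spelled out. *)
Definition dist_littleo (TT : set R) (phi : R -> 'cV[R]_p)
    (A : R -> set 'cV[R]_p) : Prop :=
  forall e : R, 0 < e ->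
    \forall T \near at_infty TT,
      (dist_set (phi T) (A T) <= (e * enorm (phi T))%:E)%E.

Definition half_approx (TT : set R) (A B : R -> set 'cV[R]_p) : Prop :=
  forall phi : R -> 'cV[R]_p,
    (forall T, TT T -> A T (phi T)) ->
    enorm (phi T) @[T --> at_infty TT] --> (0 : R) ->
    dist_littleo TT phi B.

Definition locally_approximated (TT : set R) (Phi : R -> set 'cV[R]_p)
    (L : set 'cV[R]_p) : Prop :=
  half_approx TT Phi (fun=> L) /\ half_approx TT (fun=> L) Phi.

End LocalApproximation.

Section Conditions.
Context {R : realType} {p : nat}.
Variables (Theta : set 'cV[R]_p) (theta : 'cV[R]_p).
Variables (TT : set R) (a : R -> 'M[R]_p).

Definition localU (T : R) : set 'cV[R]_p :=
  [set u | Theta (theta + a T *m u)].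

Definition from (N : nat) : set R := [set T | TT T /\ N%:R <= T].

Definition posnat : set nat := [set N | (0 < N)%N].

Definition limitU : set 'cV[R]_p :=
  \bigcap_(delta in [set d : R | 0 < d]) \bigcup_(N in posnat)
    \bigcap_(T in from N) thickening delta (localU T).

Definition condA3 : Prop :=
  \bigcap_(N in posnat) closure (\bigcup_(T in from N) localU T)
    `<=` limitU.

Definition condAn (L : set 'cV[R]_p) : Prop :=
  is_cone L /\
  exists b : R -> R,
    [/\ forall T, TT T -> 0 < b T,
        b T @[T --> at_infty TT] --> +oo &
        locally_approximated TT
          (fun T => [set (b T)^-1 *: u | u in localU T]) L].

Definition condCh1 : Prop :=
  TT = [set N%:R | N in posnat] /\
  forall T, TT T -> a T = (T `^ (- 2^-1))%:M.

Definition condCh2 (L : set 'cV[R]_p) : Prop :=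
  is_cone L /\
  locally_approximated TT (fun=> [set x - theta | x in Theta]) L.

End Conditions.

(* Main.v *)
Require Import Defs.
From HB Require Import structures.
From mathcomp Require Import all_boot all_order all_algebra.
From mathcomp Require Import all_classical all_reals all_analysis.
From mathcomp Require Import ring lra.
Import Order.TTheory GRing.Theory Num.Theory.
Import numFieldNormedType.Exports.
Local Open Scope classical_set_scope.
Local Open Scope ring_scope.

(** [limitU] is the Kuratowski lower limit of the sets [U_T] as [T] grows, and
    the intersection of closures in [condA3] is their upper limit.  As [TT] is
    unbounded, the lower limit is contained in the upper one, so [condA3] says
    that the two agree.

    For (i), it is enough to show
    [upper limit <= closure L <= lower limit].  A point [v_T] of [U_T] within
    bounded distance of the origin gives [v_T / b_T], which tends to [0] in
    [U_T / b_T]; local approximation puts it within [o(|v_T| / b_T)] of [L],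
    and multiplying by [b_T], which preserves the cone [L], puts [v_T] within
    [o(1)] of [L] ([upper_limit_sub_cone]).  The same rescaling, started from
    a fixed point of [L], gives the other inclusion ([cone_sub_lower_limit]).

    For (ii), write [X] for [Theta - theta].  Under [condCh1] the set [U_T] is
    the dilation [sqrt T *: X], so [condCh2] is the instance [b_T = sqrt T] of
    [condAn], and (i) gives one implication together with [U = closure L].

    Conversely, assume [condA3] and take [L := limitU].  Since
    [sqrt n.+1 - sqrt n] is bounded, restricting the scales to square roots of
    integers loses nothing: every scale [s >= 1] has some [sqrt n] at distance
    at most [1], and a point [x] with [s *: x] bounded is [O(1 / s)].  Hence
    [L] is both the upper and the lower limit of the dilations [s *: X] over
    all real [s] ([upper_limit_dilation_sqrt], [lower_limit_dilation_sqrt]).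
    The continuous parameter makes [L] invariant under positive multiples
    ([limit_dilation_cone]).  Compactness of the unit sphere makes the
    convergence uniform there, in both directions
    ([sphere_dilation_near_limit], [sphere_limit_near_dilation]); dilating the
    sphere of radius [|y|] onto the unit sphere turns this uniformity into the
    two little-o estimates of local approximation ([half_approx_scale]). *)

(** * Euclidean norm, closure and compactness *)

Section EuclideanNorm.
Context {R : realType} {p : nat}.
Implicit Types (x y : 'cV[R]_p) (A : set 'cV[R]_p) (k r e : R).

Lemma enorm_ge0 x : 0 <= enorm x.
Proof. exact: sqrtr_ge0. Qed.

Lemma sqr_enorm x : enorm x ^+ 2 = \sum_i x i 0 ^+ 2.
Proof. by rewrite sqr_sqrtr// sumr_ge0// => i _; exact: sqr_ge0. Qed.

Lemma enorm0 : enorm (0 : 'cV[R]_p) = 0.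
Proof.
by rewrite /enorm big1 ?sqrtr0// => i _; rewrite mxE expr0n.
Qed.

Lemma enormZ k x : enorm (k *: x) = `|k| * enorm x.
Proof.
rewrite /enorm -sqrtr_sqr -sqrtrM ?sqr_ge0// mulr_sumr.
by congr Num.sqrt; apply: eq_bigr => i _; rewrite mxE exprMn.
Qed.

Lemma ler_coord_enorm x i : `|x i 0| <= enorm x.
Proof.
rewrite -sqrtr_sqr ler_wsqrtr// (bigD1 i)//= lerDl sumr_ge0// => j _.
exact: sqr_ge0.
Qed.

Lemma enorm_eq0 x : enorm x = 0 -> x = 0.
Proof.
move=> x0; apply/matrixP => i j; rewrite ord1 mxE; apply/eqP.
by rewrite -normr_le0 -x0 ler_coord_enorm.
Qed.

Lemma enormB x y : enorm (x - y) = enorm (y - x).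
Proof. by rewrite -opprB -scaleN1r enormZ normrN1 mul1r. Qed.

(** Obtained by expanding the nonnegative square of [|y| *: x - |x| *: y]. *)
Lemma cauchy_schwarz x y : \sum_i x i 0 * y i 0 <= enorm x * enorm y.
Proof.
have [/enorm_eq0->|x0] := eqVneq (enorm x) 0.
  by rewrite enorm0 mul0r big1// => i _; rewrite mxE mul0r.
have [/enorm_eq0->|y0] := eqVneq (enorm y) 0.
  by rewrite enorm0 mulr0 big1// => i _; rewrite mxE mulr0.
have xy0 : 0 < enorm x * enorm y.
  by rewrite mulr_gt0// lt_def enorm_ge0 andbT.
rewrite -subr_ge0 -(pmulr_rge0 _ xy0).
have : 0 <= enorm (enorm y *: x - enorm x *: y) ^+ 2 by exact: sqr_ge0.
rewrite sqr_enorm.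
under eq_bigr => i _.
  rewrite !mxE.
  have -> : (enorm y * x i 0 - enorm x * y i 0) ^+ 2 =
    enorm y ^+ 2 * x i 0 ^+ 2 - (2 * enorm x * enorm y) * (x i 0 * y i 0)
    + enorm x ^+ 2 * y i 0 ^+ 2 by ring.
  over.
rewrite big_split/= sumrB -!mulr_sumr -!sqr_enorm.
set C := \sum_i _ * _; nra.
Qed.

Lemma enormD x y : enorm (x + y) <= enorm x + enorm y.
Proof.
rewrite -(ler_pXn2r (ltn0Sn 1)) ?nnegrE ?addr_ge0 ?enorm_ge0// sqr_enorm.
under eq_bigr do rewrite mxE sqrrD -mulr_natl.
rewrite !big_split/= -!sqr_enorm -mulr_sumr.
by have := cauchy_schwarz x y; set C := \sum_i _ * _; nra.
Qed.

Lemma enorm_dist_trans y x z : enorm (x - z) <= enorm (x - y) + enorm (y - z).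
Proof. by rewrite -[x - z](subrKA y); exact: enormD. Qed.

Lemma enorm_lt_coord x e : 0 < e -> (forall i, `|x i 0| < e) ->
  enorm x < p.+1%:R * e.
Proof.
move=> e0 xe.
have pe0 : 0 < p.+1%:R * e by rewrite mulr_gt0.
rewrite -(ltr_pXn2r (ltn0Sn 1)) ?nnegrE ?enorm_ge0 ?ltW// sqr_enorm.
have : \sum_i x i 0 ^+ 2 <= \sum_(i < p) e ^+ 2.
  apply: ler_sum => i _; rewrite -real_normK ?num_real//.
  by rewrite ler_pXn2r ?nnegrE ?(ltW e0)// ltW.
rewrite sumr_const card_ord => /le_lt_trans; apply.
rewrite exprMn -(mulr_natl (e ^+ 2)) ltr_pM2r ?exprn_gt0//.
by rewrite -natrX ltr_nat expnS expn1 mulSn; apply: leq_trans (leq_addr _ _).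
Qed.

(** Carries closures from the library topology, which is that of the entrywise
    maximum norm, to Euclidean distances. *)
Lemma closure_enormP A x :
  closure A x <-> forall e, 0 < e -> exists2 y, A y & enorm (x - y) < e.
Proof.
split=> [Ax e e0|Ax B /nbhs_ballP[e /= e0 eB]].
  have d0 : 0 < e / p.+1%:R by rewrite divr_gt0.
  have [y [Ay [_ xy]]] := Ax _ (nbhsx_ballx x _ d0).
  exists y => //; have -> : e = p.+1%:R * (e / p.+1%:R).
    by rewrite mulrC divfK// pnatr_eq0.
  by apply: enorm_lt_coord => // i; have := xy i 0; rewrite !mxE.
have [y Ay xy] := Ax _ e0; exists y; split => //; apply: eB; split=> // i j.
rewrite ord1 /ball/=; apply: le_lt_trans xy.
by have := ler_coord_enorm (x - y) i; rewrite !mxE.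
Qed.

Lemma dist_set_lt x A r :
  (dist_set x A < r%:E)%E <-> exists2 y, A y & enorm (x - y) < r.
Proof.
split=> [/ereal_inf_lt[_ [y Ay <-]]|[y Ay xy]].
  by rewrite lte_fin => xy; exists y.
by apply: (@le_lt_trans _ _ (enorm (x - y))%:E);
  [apply: ereal_inf_lbound; exists y|rewrite lte_fin].
Qed.

Lemma dist_set_le x A r y : A y -> enorm (x - y) <= r ->
  (dist_set x A <= r%:E)%E.
Proof.
by move=> Ay xy; apply: (@le_trans _ _ (enorm (x - y))%:E);
  [apply: ereal_inf_lbound; exists y|rewrite lee_fin].
Qed.

(** Transposing gives row vectors whose entries lie in [[-1, 1]], and a product
    of segments is compact. *)
Lemma enorm_bounded_cluster (y : nat -> 'cV[R]_p) : (forall n, enorm (y n) <= 1) ->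
  exists v, forall e N, 0 < e -> exists2 n, (N <= n)%N & enorm (v - y n) < e.
Proof.
move=> y1.
pose z n : 'rV[R]_p := (y n)^T.
have cK := @rV_compact R p (fun=> `[-1, 1]%classic) (fun=> @segment_compact R (-1) 1).
have FK : (z @ \oo) [set v : 'rV[R]_p | forall i, `[-1, 1]%classic (v ord0 i)].
  exists 0%N => // n _ i; rewrite /= in_itv/= mxE -ler_norml.
  exact: le_trans (ler_coord_enorm _ _) (y1 n).
have [w [_ wcl]] := cK _ _ FK.
exists w^T => e N e0.
have d0 : 0 < e / p.+1%:R by rewrite divr_gt0.
have FN : (z @ \oo) (z @` [set n | (N <= n)%N]) by exists N => // n /= Nn; exists n.
have [_ [[n Nn <-] [_ wz]]] := wcl _ _ FN (nbhsx_ballx w _ d0).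
exists n => //; have -> : e = p.+1%:R * (e / p.+1%:R).
  by rewrite mulrC divfK// pnatr_eq0.
by apply: enorm_lt_coord => // i; have := wz 0 i; rewrite !mxE.
Qed.

End EuclideanNorm.

(** * Kuratowski limits of families of sets *)

Section SetLimits.
Context {R : realType} {p : nat}.
Implicit Types (TT : set R) (U : R -> set 'cV[R]_p) (L : set 'cV[R]_p).

#[local] Instance at_infty_filter TT : Filter (at_infty TT).
Proof. exact: within_filter. Qed.

Lemma near_at_infty TT (P : R -> Prop) :
  (\forall T \near at_infty TT, P T) <->
  exists M, forall T, TT T -> M < T -> P T.
Proof.
split=> [[M [_ MP]]|[M MP]]; first by exists M => T TTT /MP; exact.
by exists M; split; [exact: num_real|move=> T MT TTT; exact: MP].
Qed.

(** The Kuratowski lower and upper limits of the family [U], for the Euclidean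
    distance. *)
Definition lower_limit TT U : set 'cV[R]_p :=
  [set u | forall e, 0 < e ->
    \forall T \near at_infty TT, exists2 v, U T v & enorm (u - v) < e].

Definition upper_limit TT U : set 'cV[R]_p :=
  [set u | forall e M, 0 < e ->
    exists T v, [/\ TT T, M < T, U T v & enorm (u - v) < e]].

Lemma lower_limit_sub_upper TT U : (forall M, exists2 T, TT T & M < T) ->
  lower_limit TT U `<=` upper_limit TT U.
Proof.
move=> TTinf u Uu e M e0; have /near_at_infty[N NU] := Uu _ e0.
have [T TTT] := TTinf (Num.max M N); rewrite gt_max => /andP[MT NT].
by have [v Uv uv] := NU _ TTT NT; exists T, v.
Qed.

Lemma upper_limit_closed TT U : closure (upper_limit TT U) `<=` upper_limit TT U.
Proof.
move=> u /closure_enormP clu e M e0.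
have e2 : 0 < e / 2 by rewrite divr_gt0.
have [w Ww uw] := clu _ e2; have [T [v [TTT MT UTv wv]]] := Ww _ M e2.
exists T, v; split=> //; apply: le_lt_trans (enorm_dist_trans w _ _) _.
by lra.
Qed.

Lemma limitUE TT (Theta : set 'cV[R]_p) theta a :
  limitU Theta theta TT a = lower_limit TT (localU Theta theta a).
Proof.
apply/seteqP; split=> u Uu e e0.
  have [N _ NU] := Uu _ e0; apply/near_at_infty; exists N%:R => T TTT NT.
  by apply/dist_set_lt; apply: NU; split=> //; exact: ltW.
have /near_at_infty[M MU] := Uu _ e0.
exists (Num.truncn M).+1 => // T [TTT MT]; apply/dist_set_lt/MU => //.
by apply: lt_le_trans MT; exact: truncnS_gt.
Qed.

Lemma bigcap_closureE TT U :
  \bigcap_(N in posnat) closure (\bigcup_(T in from TT N) U T) =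
  upper_limit TT U.
Proof.
apply/seteqP; split=> u Uu.
  move=> e M e0.
  have /closure_enormP/(_ _ e0)[v [T [TTT NT] UTv uv]] := Uu (Num.truncn M).+1 isT.
  exists T, v; split=> //.
  by apply: lt_le_trans NT; exact: truncnS_gt.
move=> N _; apply/closure_enormP => e e0.
have [T [v [TTT NT UTv uv]]] := Uu e N%:R e0.
by exists v => //; exists T => //; split=> //; exact: ltW.
Qed.

Lemma condA3E TT (Theta : set 'cV[R]_p) theta a :
  condA3 Theta theta TT a <->
  upper_limit TT (localU Theta theta a) `<=` lower_limit TT (localU Theta theta a).
Proof. by rewrite /condA3 bigcap_closureE limitUE. Qed.

End SetLimits.

(** * Families approximated by a cone after rescaling *)

Section ScaledFamilies.
Context {R : realType} {p : nat}.
Variables (TT : set R) (U : R -> set 'cV[R]_p) (L : set 'cV[R]_p) (b : R -> R).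
Hypotheses (b_gt0 : forall T, TT T -> 0 < b T)
  (b_infty : b T @[T --> at_infty TT] --> +oo) (coneL : is_cone L).

(** Produces the vanishing families that local approximation asks for, out of
    bounded ones. *)
Lemma cvg_enorm_div (f : R -> 'cV[R]_p) (K : R) :
  (forall T, TT T -> b T * enorm (f T) <= K) ->
  enorm (f T) @[T --> at_infty TT] --> (0 : R).
Proof.
move=> fK; apply/cvgr0Pnorm_lt => e e0.
have K0 : 0 < `|K| + 1 by rewrite ltr_pwDr.
have /near_at_infty[M Mb] :=
  (@cvgryPgt _ _ _ (at_infty_filter TT) b).1 b_infty ((`|K| + 1) / e).
apply/near_at_infty; exists M => T TTT MT.
rewrite ger0_norm ?enorm_ge0//.
have := Mb _ TTT MT; rewrite ltr_pdivrMr// => Kb.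
rewrite -(ltr_pM2l (b_gt0 _ TTT)); apply: le_lt_trans (fK _ TTT) _.
by apply: lt_trans Kb; apply: le_lt_trans (ler_norm _) _; rewrite ltrDl.
Qed.

(** A family [v_T] of points of [U T] close to [u] exists only for some [T]; at
    the other [T] it is completed by [0], which keeps it bounded.  Rescaled by
    [b T], it then tends to [0] and the approximation by [L] applies to it. *)
Lemma upper_limit_sub_cone : (forall T, TT T -> U T 0) ->
  half_approx TT (fun T => [set (b T)^-1 *: u | u in U T]) (fun=> L) ->
  upper_limit TT U `<=` closure L.
Proof.
move=> U0 UL u Uu; apply/closure_enormP => e e0.
pose good T v := U T v /\ enorm (u - v) < e / 4.
have /choice[v vP] T : exists v : 'cV[R]_p, TT T ->
    [/\ U T v, enorm v <= enorm u + e / 4 &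
      (exists w, good T w) -> enorm (u - v) < e / 4].
  have [[w [Uw uw]]|nw] := pselect (exists w, good T w).
    exists w => _; split=> //; have := enormD u (w - u).
    by rewrite subrKC (enormB w) => /le_trans; apply; rewrite lerD2l ltW.
  exists 0 => TTT; split; [exact: U0| |by move/nw].
  by rewrite enorm0 addr_ge0 ?enorm_ge0// ltW// divr_gt0.
(* All [v T] have norm at most [K]: an approximation of relative precision
   [e / 4 / K] is off by at most [e / 4] once multiplied by [b T]. *)
pose K := enorm u + e / 4.
have K0 : 0 < K by rewrite ltr_wpDl ?enorm_ge0 ?divr_gt0.
have bb T : TT T -> b T * `|(b T)^-1| = 1.
  by move=> /b_gt0 bT; rewrite gtr0_norm ?invr_gt0// mulfV// gt_eqF.
have phi0 : enorm ((b T)^-1 *: v T) @[T --> at_infty TT] --> (0 : R).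
  apply: (cvg_enorm_div _ K) => T TTT; rewrite enormZ mulrA bb// mul1r.
  by have [] := vP _ TTT.
have phiU T : TT T -> [set (b T)^-1 *: u | u in U T] ((b T)^-1 *: v T).
  by move=> TTT; exists (v T) => //; have [] := vP _ TTT.
have d0 : 0 < e / 4 / K by rewrite !divr_gt0.
have /near_at_infty[M ML] := UL _ phiU phi0 _ d0.
have e4 : 0 < e / 4 by rewrite divr_gt0.
have [T [w [TTT MT Uw uw]]] := Uu _ M e4.
have [_ vK /(_ (ex_intro _ w (conj Uw uw))) uv] := vP _ TTT.
have bT := b_gt0 _ TTT.
have : (dist_set ((b T)^-1 *: v T) L < (e / 2 / b T)%:E)%E.
  apply: le_lt_trans (ML _ TTT MT) _; rewrite lte_fin enormZ.
  rewrite gtr0_norm ?invr_gt0//.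
  rewrite mulrCA [ltRHS]mulrC ltr_pM2l ?invr_gt0//.
  apply: (@le_lt_trans _ _ (e / 4)); last by lra.
  by rewrite mulrAC ler_pdivrMr// ler_wpM2l// ltW.
move=> /dist_set_lt[l Ll vl].
exists (b T *: l); first exact: (coneL.2 _ _ Ll (ltW bT)).
apply: le_lt_trans (enorm_dist_trans (v T) _ _) _.
have : enorm (v T - b T *: l) < e / 2.
  have -> : v T - b T *: l = b T *: ((b T)^-1 *: v T - l).
    by rewrite scalerBr scalerA mulfV ?scale1r// gt_eqF.
  by rewrite enormZ gtr0_norm// mulrC -ltr_pdivlMr.
by lra.
Qed.

Lemma cone_sub_lower_limit :
  half_approx TT (fun=> L) (fun T => [set (b T)^-1 *: u | u in U T]) ->
  closure L `<=` lower_limit TT U.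
Proof.
move=> LU u /closure_enormP clu e e0.
have e2 : 0 < e / 2 by rewrite divr_gt0.
have [l Ll ul] := clu _ e2.
(* The [1] makes [K] positive even when [l] is zero. *)
pose K := enorm l + 1; have K0 : 0 < K by rewrite ltr_wpDl ?enorm_ge0.
have phi0 : enorm ((b T)^-1 *: l) @[T --> at_infty TT] --> (0 : R).
  apply: (cvg_enorm_div _ (enorm l)) => T /b_gt0 bT.
  by rewrite enormZ gtr0_norm ?invr_gt0// mulVKf// gt_eqF.
have phiL T : TT T -> L ((b T)^-1 *: l).
  by move=> /b_gt0 bT; apply: coneL.2 => //; rewrite invr_ge0 ltW.
have d0 : 0 < e / 2 / K by rewrite divr_gt0.
have /near_at_infty[M MU] := LU _ phiL phi0 _ d0.
apply/near_at_infty; exists M => T TTT MT; have bT := b_gt0 _ TTT.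
have : (dist_set ((b T)^-1 *: l) [set (b T)^-1 *: u | u in U T]
    < (e / 2 / b T)%:E)%E.
  apply: le_lt_trans (MU _ TTT MT) _; rewrite lte_fin enormZ.
  rewrite gtr0_norm ?invr_gt0// mulrCA [ltRHS]mulrC ltr_pM2l ?invr_gt0//.
  by rewrite mulrAC ltr_pdivrMr// ltr_pM2l// ltrDl.
move=> /dist_set_lt[_ [v Uv <-] lv]; exists v => //.
apply: le_lt_trans (enorm_dist_trans l _ _) _.
have : enorm (l - v) < e / 2.
  move: lv; rewrite -scalerBr enormZ gtr0_norm ?invr_gt0// [ltRHS]mulrC.
  by rewrite ltr_pM2l ?invr_gt0.
by lra.
Qed.

End ScaledFamilies.

(** * Dilations of a set and their limits *)

Section Dilations.
Context {R : realType} {p : nat}.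
Implicit Types (X L : set 'cV[R]_p) (TT : set R).

Definition dilation X (s : R) : set 'cV[R]_p := [set s *: x | x in X].

(** If [s *: x] is near [u] and [s] is large, then [x] is small, so that a
    bounded change of [s] moves [s *: x] very little. *)
Lemma enorm_dilation_shift (u : 'cV[R]_p) e : 0 < e -> exists S, 0 < S /\
  forall s r x, S < s -> `|s - r| <= 1 -> enorm (u - s *: x) < e / 2 ->
    enorm (u - r *: x) < e.
Proof.
move=> e0; have e2 : 0 < e / 2 by rewrite divr_gt0.
pose K := enorm u + e / 2.
have K0 : 0 < K by rewrite ltr_wpDl ?enorm_ge0.
exists (K / (e / 2)); split=> [|s r x]; first by rewrite divr_gt0.
rewrite ltr_pdivrMr// => Ks sr usx.
have s0 : 0 < s by rewrite -(pmulr_lgt0 _ e2) (lt_trans K0).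
have sxK : s * enorm x < K.
  rewrite -[X in X * _](gtr0_norm s0) -enormZ.
  have := enormD u (s *: x - u); rewrite subrKC (enormB (s *: x)) /K.
  by lra.
have x_small : enorm x < e / 2 by rewrite -(ltr_pM2l s0) (lt_trans sxK).
apply: le_lt_trans (enorm_dist_trans (s *: x) _ _) _.
have : enorm (s *: x - r *: x) <= enorm x.
  by rewrite -scalerBl enormZ ler_piMl// enorm_ge0.
by lra.
Qed.

(** With [n] the integer that follows the integer part of [s ^+ 2], one has
    [s ^+ 2 < n <= s ^+ 2 + 1 <= (s + 1) ^+ 2]. *)
Lemma sqrt_nat_approx (s : R) : 1 <= s -> exists n : nat,
  [/\ (0 < n)%N, s < n%:R, s <= Num.sqrt n%:R & `|s - Num.sqrt n%:R| <= 1].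
Proof.
move=> s1; have s0 : 0 <= s by exact: le_trans s1.
have /truncn_itv/andP[t_le lt_t] : 0 <= s ^+ 2 by exact: sqr_ge0.
exists (Num.truncn (s ^+ 2)).+1.
have s_le : s <= Num.sqrt (Num.truncn (s ^+ 2)).+1%:R.
  by rewrite -{1}(ger0_norm s0) -sqrtr_sqr ler_wsqrtr// ltW.
split=> //; first by apply: le_lt_trans lt_t; rewrite expr2 ler_peMl.
rewrite distrC ger0_norm ?subr_ge0// lerBlDl.
rewrite -[leRHS]ger0_norm ?addr_ge0// -sqrtr_sqr ler_wsqrtr//.
by rewrite -natr1; nra.
Qed.

Let PN : set R := [set N%:R | N in posnat].

Lemma upper_limit_dilation_sqrt X :
  upper_limit setT (dilation X) `<=`
  upper_limit PN (fun T => dilation X (Num.sqrt T)).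
Proof.
move=> u Uu e M e0; have [S [S0 SP]] := enorm_dilation_shift u _ e0.
have e2 : 0 < e / 2 by rewrite divr_gt0.
have [s [_ [_ + [x Xx <-] ux]]] := Uu _ (Num.max 1 (Num.max S M)) e2.
rewrite !gt_max => /and3P[/ltW s1 Ss Ms].
have [n [n0 sn _ sqn]] := sqrt_nat_approx _ s1.
exists n%:R, (Num.sqrt n%:R *: x); split; [by exists n|exact: lt_trans sn| |].
  by exists x.
exact: SP ux.
Qed.

Lemma lower_limit_dilation_sqrt X :
  lower_limit PN (fun T => dilation X (Num.sqrt T)) `<=`
  lower_limit setT (dilation X).
Proof.
move=> u Uu e e0; have [S [S0 SP]] := enorm_dilation_shift u _ e0.
have e2 : 0 < e / 2 by rewrite divr_gt0.
have /near_at_infty[M MU] := Uu _ e2.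
apply/near_at_infty; exists (Num.max 1 (Num.max S M)) => s _.
rewrite !gt_max => /and3P[/ltW s1 Ss Ms].
have [n [n0 sn ssqn sqn]] := sqrt_nat_approx _ s1.
have [|_ [x Xx <-] ux] := MU n%:R _ (lt_trans Ms sn); first by exists n.
exists (s *: x); first by exists x.
by apply: SP ux; [exact: lt_le_trans ssqn|rewrite distrC].
Qed.

(** Approximation of the unit sphere, uniform in the scale [s], is the little-o
    condition seen after division by the norm: it is used at
    [s = |phi T|^-1], which is large because [phi T] is small. *)
Lemma half_approx_scale TT (A B : set 'cV[R]_p) : A 0 -> B 0 ->
  (forall e, 0 < e -> exists S, forall s y, S < s -> A y -> enorm (s *: y) = 1 ->
     exists2 z, B z & enorm (s *: y - s *: z) < e) ->
  half_approx TT (fun=> A) (fun=> B).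
Proof.
move=> A0 B0 AB phi phiA phi0 e e0; have [S SP] := AB _ e0.
have S1 : 0 < `|S| + 1 by rewrite ltr_pwDr.
have d0 : 0 < (`|S| + 1)^-1 by rewrite invr_gt0.
have /near_at_infty[M Mphi] :=
  (@cvgr0Pnorm_lt _ _ _ _ (at_infty_filter TT) _).1 phi0 _ d0.
apply/near_at_infty; exists M => T TTT MT.
have := Mphi _ TTT MT; rewrite ger0_norm ?enorm_ge0// => phi_small.
have [phiT0|phiTN0] := eqVneq (enorm (phi T)) 0.
  by apply: (dist_set_le _ _ _ _ B0); rewrite subr0 phiT0 mulr0.
have phiT_gt0 : 0 < enorm (phi T) by rewrite lt_def phiTN0 enorm_ge0.
have [| | |z Bz] := SP (enorm (phi T))^-1 (phi T).
- have : `|S| + 1 < (enorm (phi T))^-1.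
    by rewrite -[ltLHS]invrK ltf_pV2 ?posrE.
  by apply: le_lt_trans; rewrite (le_trans (ler_norm _))// lerDl.
- exact: phiA.
- by rewrite enormZ gtr0_norm ?invr_gt0// mulVf.
rewrite -scalerBr enormZ gtr0_norm ?invr_gt0// ltr_pdivrMl// mulrC => zs.
by apply: (dist_set_le _ _ _ _ Bz); exact: ltW.
Qed.

Section TangentCone.
Context {X L : set 'cV[R]_p}.
Hypotheses (X0 : X 0) (upperL : upper_limit setT (dilation X) `<=` L)
  (lowerL : L `<=` lower_limit setT (dilation X)).

Lemma limit_dilation0 : L 0.
Proof.
apply: upperL => e M e0; exists (M + 1), 0; split=> //.
- by rewrite ltrDl.
- by exists 0; rewrite ?scaler0.
- by rewrite subrr enorm0.
Qed.

(** If [s *: x] is near [l], then [(t * s) *: x] is near [t *: l] and is again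
    a dilate of a point of [X]; this is where all real scales are needed. *)
Lemma limit_dilation_cone : is_cone L.
Proof.
split=> [|l t Ll]; first by exists 0; exact: limit_dilation0.
rewrite le_eqVlt => /predU1P[<-|t0].
  by rewrite scale0r; exact: limit_dilation0.
apply: upperL => e M e0.
have et0 : 0 < e / t by rewrite divr_gt0.
have /near_at_infty[S SX] := lowerL _ Ll _ et0.
pose s := Num.max S (M / t) + 1.
have [_ [x Xx <-] lx] : exists2 v, dilation X s v & enorm (l - v) < e / t.
  by apply: SX => //; rewrite ltr_pwDr// le_max lexx.
exists (t * s), ((t * s) *: x); split=> //.
- by rewrite mulrC -ltr_pdivrMr// ltr_pwDr// le_max lexx orbT.
- by exists x.
- by rewrite -scalerA -scalerBr enormZ gtr0_norm// mulrC -ltr_pdivlMr.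
Qed.

Lemma limit_dilation_closed : closure L `<=` L.
Proof.
have TTinf (M : R) : exists2 T, setT T & M < T by exists (M + 1); rewrite ?ltrDl.
have Lupper := subset_trans lowerL (lower_limit_sub_upper _ _ TTinf).
exact: subset_trans (closure_subset Lupper)
  (subset_trans (upper_limit_closed _ _) upperL).
Qed.

(** Otherwise there are unit vectors [s_n *: x_n] that stay away from [L], with
    [s_n] unbounded; a cluster point of them is in the upper limit, hence
    in [L]. *)
Lemma sphere_dilation_near_limit e : 0 < e -> exists S, forall s x,
  S < s -> X x -> enorm (s *: x) = 1 ->
  exists2 v, L v & enorm (s *: x - v) < e.
Proof.
move=> e0; apply: contrapT => /forallNP noS.
have /choice[f fP] (n : nat) : exists sx : R * 'cV[R]_p,
    [/\ n%:R < sx.1, X sx.2, enorm (sx.1 *: sx.2) = 1 &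
      forall v, L v -> e <= enorm (sx.1 *: sx.2 - v)].
  apply: contrapT => nf; apply: (noS n%:R) => s x ns Xx sx1.
  apply: contrapT => nv; apply: nf; exists (s, x); split=> //= v Lv.
  by rewrite leNgt; apply/negP => lt_e; apply: nv; exists v.
have [n|v vP] := enorm_bounded_cluster (fun n => (f n).1 *: (f n).2).
  by have [_ _ ->] := fP n.
have Lv : L v.
  apply: upperL => e' M e'0.
  have [n Nn vn] := vP e' (Num.truncn M).+1 e'0.
  have [nf Xf _ _] := fP n.
  exists (f n).1, ((f n).1 *: (f n).2); split=> //; last by exists (f n).2.
  apply: lt_trans nf; apply: lt_le_trans (truncnS_gt _) _.
  by rewrite ler_nat.
have [n _] := vP e 0%N e0; have [_ _ _ /(_ v Lv)] := fP n.
by rewrite enormB leNgt => /negP.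
Qed.

(** Otherwise there are unit vectors [l_n] of [L] that stay away from
    [s_n *: X], with [s_n] unbounded; a cluster point of them is in the closed
    set [L], hence in the lower limit, and is close to all [s *: X] with [s]
    large. *)
Lemma sphere_limit_near_dilation e : 0 < e -> exists S, forall s l,
  S < s -> L l -> enorm l = 1 -> exists2 x, X x & enorm (l - s *: x) < e.
Proof.
move=> e0; apply: contrapT => /forallNP noS.
have /choice[f fP] (n : nat) : exists sl : R * 'cV[R]_p,
    [/\ n%:R < sl.1, L sl.2, enorm sl.2 = 1 &
      forall x, X x -> e <= enorm (sl.2 - sl.1 *: x)].
  apply: contrapT => nf; apply: (noS n%:R) => s l ns Ll l1.
  apply: contrapT => nx; apply: nf; exists (s, l); split=> //= x Xx.
  by rewrite leNgt; apply/negP => lt_e; apply: nx; exists x.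
have [n|v vP] := enorm_bounded_cluster (fun n => (f n).2).
  by have [_ _ ->] := fP n.
have Lv : L v.
  apply: limit_dilation_closed; apply/closure_enormP => e' e'0.
  by have [n _ vn] := vP e' 0%N e'0; exists (f n).2 => //; have [] := fP n.
have e2 : 0 < e / 2 by rewrite divr_gt0.
have /near_at_infty[M MX] := lowerL _ Lv _ e2.
have [n Nn vn] := vP _ (Num.truncn M).+1 e2.
have [nf Lf _ fX] := fP n.
have [//||_ [x Xx <-] vx] := MX (f n).1.
  apply: lt_trans nf; apply: lt_le_trans (truncnS_gt _) _.
  by rewrite ler_nat.
have := fX x Xx; have := enorm_dist_trans v (f n).2 ((f n).1 *: x).
by rewrite (enormB _ v); lra.
Qed.

Lemma limit_dilation_locally_approximated TT :
  locally_approximated TT (fun=> X) L.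
Proof.
have coneL := limit_dilation_cone.
split; apply: half_approx_scale; try exact: X0; try exact: limit_dilation0.
  move=> e /sphere_dilation_near_limit[S SP].
  exists (Num.max S 0) => s x; rewrite gt_max => /andP[Ss s0] Xx sx1.
  have [v Lv sxv] := SP _ _ Ss Xx sx1.
  exists (s^-1 *: v); first by apply: coneL.2; rewrite // invr_ge0 ltW.
  by rewrite scalerA mulfV ?scale1r// gt_eqF.
move=> e /sphere_limit_near_dilation[S SP].
exists (Num.max S 0) => s l; rewrite gt_max => /andP[Ss s0] Ll sl1.
by apply: SP => //; apply: coneL.2; rewrite // ltW.
Qed.

End TangentCone.
End Dilations.

(** * Local parameter sets *)

Section LocalParameterSets.
Context {R : realType} {p : nat}.
Implicit Types (TT : set R) (Theta L : set 'cV[R]_p) (theta : 'cV[R]_p).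

Lemma eq_lower_limit TT (U V : R -> set 'cV[R]_p) :
  (forall T, TT T -> U T = V T) -> lower_limit TT U `<=` lower_limit TT V.
Proof.
move=> UV u Uu e e0; have /near_at_infty[M MU] := Uu _ e0.
by apply/near_at_infty; exists M => T TTT MT; rewrite -UV//; exact: MU.
Qed.

Lemma eq_upper_limit TT (U V : R -> set 'cV[R]_p) :
  (forall T, TT T -> U T = V T) -> upper_limit TT U `<=` upper_limit TT V.
Proof.
move=> UV u Uu e M e0; have [T [v [TTT MT UTv uv]]] := Uu _ M e0.
by exists T, v; split=> //; rewrite -UV.
Qed.

Lemma eq_half_approx TT (A A' B B' : R -> set 'cV[R]_p) :
  (forall T, TT T -> A T = A' T) -> (forall T, TT T -> B T = B' T) ->
  half_approx TT A B -> half_approx TT A' B'.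
Proof.
move=> AA' BB' AB phi phiA phi0 e e0.
have phiA' T : TT T -> A T (phi T) by move=> TTT; rewrite AA'//; exact: phiA.
have /near_at_infty[M MB] := AB _ phiA' phi0 _ e0.
by apply/near_at_infty; exists M => T TTT MT; rewrite -BB'//; exact: MB.
Qed.

Lemma limitU_condAn TT Theta theta a L : Theta theta ->
  (forall M, exists2 T, TT T & M < T) ->
  condAn Theta theta TT a L ->
  condA3 Theta theta TT a /\ limitU Theta theta TT a = closure L.
Proof.
move=> Theta_theta TTinf [coneL [b [b_gt0 b_infty [UL LU]]]].
have upperL := upper_limit_sub_cone _ _ _ _ b_gt0 b_infty coneL _ UL.
have {}upperL : upper_limit TT (localU Theta theta a) `<=` closure L.
  by apply: upperL => T _; rewrite /localU/= mulmx0 addr0.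
have lowerL := cone_sub_lower_limit _ _ _ _ b_gt0 b_infty coneL LU.
split; first by apply/condA3E; exact: subset_trans lowerL.
rewrite limitUE; apply/seteqP; split=> //.
exact: subset_trans (lower_limit_sub_upper _ _ TTinf) upperL.
Qed.

Lemma localU_dilation Theta theta a (T : R) :
  0 < T -> a T = (T `^ (- 2^-1))%:M ->
  localU Theta theta a T = dilation [set x - theta | x in Theta] (Num.sqrt T).
Proof.
move=> T0 aT; have sT : Num.sqrt T != 0 by rewrite gt_eqF// sqrtr_gt0.
rewrite /localU aT powRN powR12_sqrt ?ltW//.
apply/seteqP; split=> [u/= Uu|_ [_ [x Tx <-] <-]/=].
  exists ((Num.sqrt T)^-1 *: u); last by rewrite scalerA mulfV// scale1r.
  exists (theta + (Num.sqrt T)^-1 *: u); first by rewrite -mul_scalar_mx.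
  by rewrite addrC addKr.
by rewrite mul_scalar_mx scalerA mulVf// scale1r subrKC.
Qed.

Lemma sqrt_at_infty TT : Num.sqrt T @[T --> at_infty TT] --> +oo.
Proof.
apply/(@cvgryPgt _ _ _ (at_infty_filter TT)) => A.
apply/near_at_infty; exists (A ^+ 2) => T _ AT.
apply: le_lt_trans (ler_norm _) _.
by rewrite -sqrtr_sqr ltr_sqrt// (le_lt_trans (sqr_ge0 A)).
Qed.

Lemma condCh1_gt0 TT (a : R -> 'M[R]_p) : condCh1 TT a ->
  forall T, TT T -> 0 < T.
Proof. by move=> [-> _] _ [n n0 <-]; rewrite ltr0n. Qed.

Lemma condAn_condCh2 TT Theta theta a L :
  condCh1 TT a -> condCh2 Theta theta TT L -> condAn Theta theta TT a L.
Proof.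
move=> Ch1 [coneL [XL LX]]; have TT_gt0 := condCh1_gt0 _ _ Ch1.
split=> //; exists Num.sqrt; split; [|exact: sqrt_at_infty|].
  by move=> T /TT_gt0; rewrite sqrtr_gt0.
have XE T : TT T -> [set x - theta | x in Theta] =
    [set (Num.sqrt T)^-1 *: u | u in localU Theta theta a T].
  move=> TTT; rewrite localU_dilation ?TT_gt0//; last exact: Ch1.2.
  have sT : Num.sqrt T != 0 by rewrite gt_eqF// sqrtr_gt0 TT_gt0.
  apply/seteqP; split=> [x Xx|_ [_ [x Xx <-] <-]].
    exists (Num.sqrt T *: x); first by exists x.
    by rewrite scalerA mulVf// scale1r.
  by rewrite scalerA mulVf// scale1r.
by split; [apply: eq_half_approx XL|apply: eq_half_approx LX].
Qed.

Lemma condCh2_limitU TT Theta theta a : Theta theta ->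
  condCh1 TT a -> condA3 Theta theta TT a ->
  condCh2 Theta theta TT (limitU Theta theta TT a).
Proof.
move=> Theta_theta Ch1 /condA3E A3; have TT_gt0 := condCh1_gt0 _ _ Ch1.
set X := [set x - theta | x in Theta].
have UE T : TT T -> localU Theta theta a T = dilation X (Num.sqrt T).
  by move=> TTT; apply: localU_dilation; [exact: TT_gt0|exact: Ch1.2].
have UE' T : TT T -> dilation X (Num.sqrt T) = localU Theta theta a T.
  by move=> /UE.
have X0 : X 0 by exists theta; rewrite ?subrr.
rewrite limitUE; set L := lower_limit _ _ in A3 *.
have upperL : upper_limit setT (dilation X) `<=` L.
  apply: subset_trans (upper_limit_dilation_sqrt _) _; rewrite -Ch1.1.
  exact: subset_trans (eq_upper_limit _ _ _ UE') A3.
have lowerL : L `<=` lower_limit setT (dilation X).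
  apply: subset_trans (eq_lower_limit _ _ _ UE) _; rewrite Ch1.1.
  exact: lower_limit_dilation_sqrt.
split; first exact: limit_dilation_cone X0 upperL lowerL.
exact: limit_dilation_locally_approximated X0 upperL lowerL _.
Qed.

End LocalParameterSets.

Theorem theorem2p8 (R : realType) (p : nat)
    (Theta : set 'cV[R]_p) (theta : 'cV[R]_p)
    (TT : set R) (a : R -> 'M[R]_p)
    (Theta_meas : borel_set Theta)
    (Theta_theta : Theta theta)
    (TT_sup : ereal_sup [set T%:E | T in TT] = +oo%E)
    (a_unit : forall T, TT T -> a T \in unitmx)
    (a_cvg0 : opnorm (a T) @[T --> at_infty TT] --> (0 : R)) :
  (forall L : set 'cV[R]_p, condAn Theta theta TT a L ->
     condA3 Theta theta TT a /\ limitU Theta theta TT a = closure L) /\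
  (condCh1 TT a ->
     (condA3 Theta theta TT a <->
        exists L : set 'cV[R]_p, condCh2 Theta theta TT L) /\
     (forall L : set 'cV[R]_p, condCh2 Theta theta TT L ->
        limitU Theta theta TT a = closure L)).
Proof.
have TTinf M : exists2 T, TT T & M < T.
  have : (M%:E < ereal_sup [set T%:E | T in TT])%E by rewrite TT_sup ltry.
  by move=> /ereal_sup_gt[_ [T TTT <-]]; rewrite lte_fin => MT; exists T.
have An L := @limitU_condAn _ _ TT Theta theta a L Theta_theta TTinf.
split=> [//|Ch1]; split; last by move=> L /(condAn_condCh2 _ _ _ _ _ Ch1)/An[].
split=> [A3|[L /(condAn_condCh2 _ _ _ _ _ Ch1)/An[]]//].
by exists (limitU Theta theta TT a); exact: condCh2_limitU.
Qed.
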